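(* Let $\ell\ge1$ and $a$ be integers with $\ell<a-1$. Then $$h_{\{-\ell\},\{a\}}^{\{a+j\}}=\begin{cases} q^{\frac{j+\ell}{2}-1}(q-1) & j=\ell-2,\ell-4,\dots,2-\ell,\\ 1 & j=-\ell,\\ q^\ell & j=\ell.\end{cases}$$
   Context: $k$ is a finite field with $q$ elements, $\mathrm{char}(k)\neq2$. Let $G=\mathrm{GL}_2(k((z)))$, $K=\mathrm{GL}_2(k[[z]])$, $H=\mathrm{GL}_2(k((z^2)))$, with Haar measure on $G$ giving $K$ measure $1$. Here $\{-\ell\}$ denotes $(0,-\ell)$ and $\{b\}$ denotes $(b,0)$ for $b>1$. $c_{\{-\ell\}}$ is the characteristic function of $K\,\mathrm{diag}(z^{-\ell},1)\,K$; for $b>1$, $\Pi^{\{b\}}=\begin{pmatrix}1&z\\0&z^b\end{pmatrix}$ and $d_{\{b\}}$ is the characteristic function of $K\Pi^{\{b\}}H$. The structure constant is $h_{\{-\ell\},\{a\}}^{\{b\}}=(c_{\{-\ell\}}\times d_{\{b\}})(\Pi^{\{a\}})$, where $(f\times g)(x)=\int_G g(y^{-1}x)f(y)\,dy$; equivalently it is the coefficient of $d_{\{a\}}$ in $c_{\{-\ell\}}\times d_{\{b\}}$. *)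

(* Defs.v *)
From HB Require Import structures.
From mathcomp Require Import all_boot all_order all_algebra.
From mathcomp Require Import all_classical all_reals all_analysis.

Set Implicit Arguments.
Unset Strict Implicit.
Unset Printing Implicit Defensive.

Import Order.TTheory GRing.Theory Num.Theory.
Local Open Scope classical_set_scope.
Local Open Scope ring_scope.

Section Laurent.
Variable F : fieldType.

Definition laurent_pred : {pred int -> F} :=
  fun f => `[< exists N : int, forall n, n < N -> f n = 0 >].

Fact laurent_zmod_closed : zmod_closed laurent_pred.
Proof.
split=> [|f g /asboolP[N fN] /asboolP[M gM]]; apply/asboolP; first by exists 0.
exists (Order.min N M) => n; rewrite lt_min => /andP[nN nM].
by rewrite -[LHS]/(f n - g n) fN // gM // subr0.
Qed.

HB.instance Definition _ :=
  GRing.isZmodClosed.Build (int -> F) laurent_pred laurent_zmod_closed.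

(* F((z)): the series \sum_n f_n z^n is represented by n |-> f_n. *)
Definition laurent := {f : int -> F | f \in laurent_pred}.

HB.instance Definition _ := SubChoice.on laurent.
HB.instance Definition _ := [SubChoice_isSubZmodule of laurent by <:].

Definition laurent_of (f : int -> F) (lf : f \in laurent_pred) : laurent :=
  exist (fun f => f \in laurent_pred) f lf.

Definition lcoef (f : laurent) (n : int) : F := val f n.

Lemma laurent_eqP (f g : laurent) : (forall n, lcoef f n = lcoef g n) -> f = g.
Proof. by move=> fg; apply/val_inj/funext. Qed.

Lemma lcoef_bound (f : laurent) :
  exists N : int, forall n, n < N -> lcoef f n = 0.
Proof. exact/asboolP/(valP f). Qed.

Lemma lcoefD f g n : lcoef (f + g) n = lcoef f n + lcoef g n.
Proof. by []. Qed.

Lemma lcoef0 n : lcoef 0 n = 0. Proof. by []. Qed.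

(* Only finitely many terms of the sum are nonzero on Laurent series. *)
Definition lmul_coef (f g : int -> F) (n : int) : F :=
  \sum_(i \in [set: int]) f i * g (n - i).

Lemma int_lt_addn (N n : int) : n < N \/ exists d : nat, n = N + d%:Z.
Proof.
case: (ltP n N) => [|Nn]; [by left|right].
by exists `|n - N|%N; rewrite gez0_abs ?subr_ge0 // [RHS]addrC subrK.
Qed.

Lemma lmul_coef_nat (f g : int -> F) (N M : int) (d : nat) :
  (forall n, n < N -> f n = 0) -> (forall n, n < M -> g n = 0) ->
  lmul_coef f g (N + M + d%:Z) =
    \sum_(i < d.+1) f (N + i%:Z) * g (M + (d - i)%N%:Z).
Proof.
move=> fN gM; rewrite /lmul_coef; pose s := [seq N + i%:Z | i <- iota 0 d.+1].
have us : uniq s by rewrite map_inj_uniq ?iota_uniq // => x y /addrI [].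
rewrite (@fsbigE _ _ _ _ setT s) //; last first.
  move=> i _ /mapP iN; have [/fN->|[j ij]] := int_lt_addn N i.
    by rewrite mul0r.
  rewrite gM ?mulr0 // ij.
  have -> : N + M + d%:Z - (N + j%:Z) = M + (d%:Z - j%:Z).
    by rewrite opprD addrACA [N + M]addrC addrK.
  rewrite gtrDl subr_lt0 ltz_nat ltnNge; apply/negP => jd; apply: iN.
  by exists j => //; rewrite mem_iota add0n ltnS.
rewrite (eq_bigl xpredT); last by move=> i; rewrite in_setT.
rewrite big_map -[iota _ _]/(index_iota 0 d.+1) big_mkord.
apply: eq_bigr => i _; congr (_ * g _).
have id : (i <= d)%N by rewrite -ltnS.
by rewrite -subzn // opprD addrACA [N + M]addrC addrK.
Qed.

Lemma lmul_coef_lt (f g : int -> F) (N M n : int) :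
  (forall n, n < N -> f n = 0) -> (forall n, n < M -> g n = 0) ->
  n < N + M -> lmul_coef f g n = 0.
Proof.
move=> fN gM nNM; apply: fsbig1 => i _.
case: (ltP i N) => [/fN->|Ni]; first by rewrite mul0r.
rewrite gM ?mulr0 // ltrBlDr (lt_le_trans nNM) // [M + i]addrC.
by rewrite lerD2r.
Qed.

Fact lmul_subproof (f g : laurent) :
  lmul_coef (lcoef f) (lcoef g) \in laurent_pred.
Proof.
have [N fN] := lcoef_bound f; have [M gM] := lcoef_bound g.
by apply/asboolP; exists (N + M) => n; apply: lmul_coef_lt.
Qed.

Definition lmul (f g : laurent) : laurent := laurent_of (lmul_subproof f g).

Lemma lcoef_mul f g n : lcoef (lmul f g) n = lmul_coef (lcoef f) (lcoef g) n.
Proof. by []. Qed.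

Fact lmonom_subproof (m : int) : (fun n => (n == m)%:R : F) \in laurent_pred.
Proof. by apply/asboolP; exists m => n /lt_eqF ->. Qed.

Definition lmonom (m : int) : laurent := laurent_of (lmonom_subproof m).

Lemma lmulC : commutative lmul.
Proof.
move=> f g; apply: laurent_eqP => n; rewrite !lcoef_mul /lmul_coef.
rewrite (reindex_fsbigT (fun i => n - i)).
  by apply: eq_fsbigr => i _; rewrite mulrC opprB addrC subrK.
by exists (fun i => n - i) => i; rewrite opprB addrC subrK.
Qed.

Lemma lmul1 : left_id (lmonom 0) lmul.
Proof.
move=> f; apply: laurent_eqP => n; have [M fM] := lcoef_bound f.
have H0 : forall n, n < 0 -> lcoef (lmonom 0) n = 0.
  by move=> m /lt_eqF m0; rewrite /lcoef /= m0.
rewrite lcoef_mul; have [nM|[d ->]] := int_lt_addn M n.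
  by rewrite (lmul_coef_lt H0 fM) ?add0r ?fM.
rewrite -[M]add0r (lmul_coef_nat _ H0 fM) big_ord_recl big1 => [|i _].
  by rewrite addr0 add0r subn0 /lcoef /= mul1r.
by rewrite /lcoef /= mul0r.
Qed.

Lemma lmulDl : left_distributive lmul +%R.
Proof.
move=> f g h; apply: laurent_eqP => n; rewrite lcoefD.
have [N1 fN] := lcoef_bound f; have [N2 gN] := lcoef_bound g.
have [M hM] := lcoef_bound h; pose N := Order.min N1 N2.
have fN' m : m < N -> lcoef f m = 0 by rewrite lt_min => /andP[/fN].
have gN' m : m < N -> lcoef g m = 0 by rewrite lt_min => /andP[_ /gN].
have fgN m : m < N -> lcoef (f + g) m = 0.
  by move=> mN; rewrite lcoefD fN' // gN' // addr0.
rewrite !lcoef_mul; have [nM|[d ->]] := int_lt_addn (N + M) n.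
  by rewrite !(@lmul_coef_lt _ _ N M) // addr0.
rewrite !(@lmul_coef_nat _ _ N M) // -big_split; apply: eq_bigr => i _.
by rewrite lcoefD mulrDl.
Qed.

Definition ltrunc (f : laurent) (N : int) (d : nat) : {poly F} :=
  \poly_(i < d.+1) lcoef f (N + i%:Z).

Lemma lcoef_mul_trunc (f g : laurent) (N M : int) (d i : nat) :
  (forall n, n < N -> lcoef f n = 0) -> (forall n, n < M -> lcoef g n = 0) ->
  (i <= d)%N ->
  lcoef (lmul f g) (N + M + i%:Z) = (ltrunc f N d * ltrunc g M d)`_i.
Proof.
move=> fN gM id; rewrite lcoef_mul (lmul_coef_nat _ fN gM) coefM.
apply: eq_bigr => j _; rewrite !coef_poly.
have ji : (j <= i)%N by rewrite -ltnS.
rewrite !ltnS (leq_trans ji id) /= (leq_trans (leq_subr _ _) id).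
by [].
Qed.

Lemma lmulA : associative lmul.
Proof.
move=> f g h; have [N fN] := lcoef_bound f; have [M gM] := lcoef_bound g.
have [L hL] := lcoef_bound h; apply: laurent_eqP => n.
have fgN m : m < N + M -> lcoef (lmul f g) m = 0.
  exact: (lmul_coef_lt fN gM).
have ghN m : m < M + L -> lcoef (lmul g h) m = 0.
  exact: (lmul_coef_lt gM hL).
have [nM|[d ->]] := int_lt_addn (N + M + L) n.
  by rewrite !lcoef_mul (lmul_coef_lt fN ghN) ?addrA // (lmul_coef_lt fgN hL).
rewrite (lcoef_mul_trunc fgN hL (leqnn d)) -(addrA N).
rewrite (lcoef_mul_trunc fN ghN (leqnn d)).
pose P := ltrunc f N d; pose Q := ltrunc g M d; pose S := ltrunc h L d.
transitivity ((P * (Q * S))`_d); last rewrite mulrA.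
  rewrite !coefM; apply: eq_bigr => j _; congr (_ * _).
  have jd : (d - j <= d)%N by rewrite leq_subr.
  by rewrite coef_poly ltnS jd (@lcoef_mul_trunc _ _ _ _ d).
rewrite !coefM; apply: eq_bigr => j _; congr (_ * _).
have jd : (j <= d)%N by rewrite -ltnS.
by rewrite [RHS]coef_poly ltnS jd (@lcoef_mul_trunc _ _ _ _ d).
Qed.

Lemma lone_neq0 : lmonom 0 != 0.
Proof.
apply/eqP => /(congr1 (fun f => lcoef f 0)).
by rewrite lcoef0 /lcoef /= => /eqP; rewrite oner_eq0.
Qed.

HB.instance Definition _ :=
  GRing.Zmodule_isComNzRing.Build laurent lmulA lmulC lmul1 lmulDl lone_neq0.

Fixpoint lrecip_seq (a : nat -> F) (n : nat) : seq F :=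
  if n is m.+1 then
    let s := lrecip_seq a m in
    rcons s (((m == 0)%N%:R - \sum_(i < m) a i.+1 * s`_(m - i.+1)) / a 0%N)
  else [::].

Lemma lrecip_exists (a : nat -> F) : a 0%N != 0 ->
  exists c : nat -> F,
    forall n, \sum_(i < n.+1) a i * c (n - i)%N = (n == 0)%N%:R.
Proof.
move=> a0; have sz n : size (lrecip_seq a n) = n.
  by elim: n => //= n IH; rewrite size_rcons IH.
have stab n d j : (j < n)%N -> (lrecip_seq a (n + d))`_j = (lrecip_seq a n)`_j.
  move=> jn; elim: d => [|d IH]; first by rewrite addn0.
  by rewrite addnS /= nth_rcons sz (leq_trans jn (leq_addr _ _)).
exists (fun n => (lrecip_seq a n.+1)`_n) => n; rewrite big_ord_recl /= subn0.
rewrite nth_rcons sz ltnn eqxx mulrC mulfVK //.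
rewrite [X in _ + X](eq_bigr (fun i : 'I_n =>
   a i.+1 * (lrecip_seq a n)`_(n - i.+1))); first by rewrite subrK.
move=> i _; congr (_ * _).
have iln : (n - i.+1 < n)%N by rewrite ltn_subrL (leq_ltn_trans _ (ltn_ord i)).
rewrite /lift /= /bump /= add1n.
by have := stab (n - i.+1).+1 (n - (n - i.+1).+1)%N _ (ltnSn _); rewrite subnKC.
Qed.

Lemma lorder (f : laurent) : f != 0 ->
  exists N, (forall n, n < N -> lcoef f n = 0) /\ lcoef f N != 0.
Proof.
move=> f0; have [M fM] := lcoef_bound f.
have ex : exists d : nat, lcoef f (M + d%:Z) != 0.
  apply: contrapT => /forallNP H; case/eqP: f0; apply: laurent_eqP => n.
  rewrite lcoef0; have [/fM//|[d ->]] := int_lt_addn M n.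
  exact/eqP/negPn/negP.
case: (ex_minnP ex) => d fd dmin; exists (M + d%:Z); split=> // n.
have [/fM//|[e ->]] := int_lt_addn M n.
rewrite ltrD2l ltz_nat => ed; apply/eqP; apply: contraTT ed => /dmin.
by rewrite leqNgt.
Qed.

Lemma linv_exists (f : laurent) : f != 0 -> exists g : laurent, g * f = 1.
Proof.
move=> /lorder[N [fN fN0]].
have [|c cP] := @lrecip_exists (fun i => lcoef f (N + i%:Z)).
  by rewrite addr0.
pose G (n : int) : F := if n + N is Posz d then c d else 0.
have GN n : n < - N -> G n = 0.
  by rewrite /G -subr_lt0 opprK; case: (n + N).
have Glaurent : G \in laurent_pred by apply/asboolP; exists (- N).
exists (laurent_of Glaurent); apply: laurent_eqP => n; rewrite mulrC.
rewrite /lcoef /=; have [n0|[d ->]] := int_lt_addn 0 n.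
  by rewrite (lmul_coef_lt fN GN) ?subrr ?lt_eqF.
rewrite -(subrr N) (lmul_coef_nat _ fN GN) subrr add0r eqz_nat -cP.
by apply: eq_bigr => i _; rewrite /G addrAC addNr add0r.
Qed.

Definition linv (f : laurent) : laurent := xget 0 [set g | g * f = 1].

Fact lmulV (f : laurent) : f != 0 -> linv f * f = 1.
Proof.
move=> /linv_exists[g gf]; rewrite /linv.
by case: xgetP => [//|/(_ g)].
Qed.

Fact linv0 : linv 0 = 0.
Proof.
rewrite /linv; case: xgetP => // g _ /=.
by rewrite mulr0 => /esym/eqP; rewrite oner_eq0.
Qed.

HB.instance Definition _ := GRing.ComNzRing_isField.Build laurent lmulV linv0.

HB.instance Definition _ := isPointed.Build laurent 0.

(* The z-adic topology: the sets f + z^N F[[z]] form a basis at f. *)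
Definition lopen : set (set laurent) :=
  [set U | forall f, U f -> exists N : int,
     forall g, (forall n, n < N -> lcoef g n = lcoef f n) -> U g].

Fact lopenT : lopen setT.
Proof. by move=> f _; exists 0. Qed.

Fact lopenI : setI_closed lopen.
Proof.
move=> U V Uo Vo f [/Uo[N UN] /Vo[M VM]]; exists (Order.max N M) => g fg.
by split; [apply: UN|apply: VM] => n nN; apply: fg; rewrite lt_max nN ?orbT.
Qed.

Fact lopen_bigU (I : Type) (U : I -> set laurent) :
  (forall i, lopen (U i)) -> lopen (\bigcup_i U i).
Proof.
by move=> Uo f [i _ /Uo[N UN]]; exists N => g /UN; exists i.
Qed.

HB.instance Definition _ :=
  isOpenTopological.Build laurent lopenT lopenI lopen_bigU.

End Laurent.

Section GL2.
Variable F : fieldType.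
Local Notation L := (laurent F).

(* The topology of GL_2(F((z))) is induced from F((z))^4 (inversion is continuous
   for it, as F((z)) is a topological field); the measurable sets are the Borel
   sets. *)
Definition GL2 := {A : 'M[L]_2 | A \in unitmx}.

HB.instance Definition _ := SubChoice.on GL2.

Implicit Types g h : GL2.

Fact gl2_one_subproof : 1%:M \in @unitmx L 2.
Proof. exact: unitmx1. Qed.
Fact gl2_mul_subproof g h : val g *m val h \in unitmx.
Proof. by rewrite unitmx_mul; apply/andP; split; apply: valP. Qed.
Fact gl2_inv_subproof g : invmx (val g) \in unitmx.
Proof. by rewrite unitmx_inv; apply: valP. Qed.

Definition gl2_of (A : 'M[L]_2) (uA : A \in unitmx) : GL2 :=
  exist (fun A => A \in unitmx) A uA.

Definition gl2_one : GL2 := gl2_of gl2_one_subproof.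
Definition gl2_mul g h : GL2 := gl2_of (gl2_mul_subproof g h).
Definition gl2_inv g : GL2 := gl2_of (gl2_inv_subproof g).

Fact gl2_mulA : associative gl2_mul.
Proof. by move=> g h k; apply: val_inj; rewrite /= mulmxA. Qed.
Fact gl2_mul1 : left_id gl2_one gl2_mul.
Proof. by move=> g; apply: val_inj; rewrite /= mul1mx. Qed.
Fact gl2_mulr1 : right_id gl2_one gl2_mul.
Proof. by move=> g; apply: val_inj; rewrite /= mulmx1. Qed.
Fact gl2_mulV : left_inverse gl2_one gl2_inv gl2_mul.
Proof. by move=> g; apply: val_inj; rewrite /= mulVmx //; apply: valP. Qed.
Fact gl2_mulrV : right_inverse gl2_one gl2_inv gl2_mul.
Proof. by move=> g; apply: val_inj; rewrite /= mulmxV //; apply: valP. Qed.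

HB.instance Definition _ :=
  isGroup.Build GL2 gl2_mulA gl2_mul1 gl2_mulr1 gl2_mulV gl2_mulrV.

HB.instance Definition _ := isPointed.Build GL2 gl2_one.

HB.instance Definition _ :=
  PointedTopological.copy GL2 (initial_topology (val : GL2 -> 'M[L]_2)).

HB.instance Definition _ :=
  Measurable.copy GL2 (g_sigma_algebraType (@open GL2)).

End GL2.

Section StructureConstants.
Variable k : finFieldType.
Local Notation L := (laurent k).
Local Notation G := (GL2 k).

Definition zvar : L := lmonom k 1.

Definition laurent_integral : set L :=
  [set f | forall n : int, n < 0 -> lcoef f n = 0].

(* k((z^2)) *)
Definition laurent_even : set L :=
  [set f | forall n : int, ~~ (2 %| n)%Z -> lcoef f n = 0].

(* GL_2(A) inside GL_2(k((z))), for a subring A of k((z)). *)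
Definition GL2_over (A : set L) : set G :=
  [set g : G | forall i j, A (val g i j) /\ A (val (g^-1)%g i j)].

Definition Kgrp : set G := GL2_over laurent_integral.
Definition Hgrp : set G := GL2_over laurent_even.

Definition double_coset (A : set G) (x : G) (B : set G) : set G :=
  [set (a * x * b)%g | a in A & b in B].

Definition mx22 (a b c d : L) : 'M[L]_2 :=
  \matrix_(i, j) (if i == 0 then if j == 0 then a else b
                  else if j == 0 then c else d).

Lemma det_mx22 a b c d : \det (mx22 a b c d) = a * d - b * c.
Proof.
rewrite (expand_det_row _ 0) !big_ord_recl big_ord0 addr0.
by rewrite /cofactor !det_mx11 !mxE /= expr0 expr1 mul1r mulN1r mulrN.
Qed.

Lemma zvar_neq0 : zvar != 0.
Proof.
apply/eqP => /(congr1 (fun f => lcoef f 1)).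
by rewrite lcoef0 /lcoef /= => /eqP; rewrite oner_eq0.
Qed.

Fact diagz_subproof (m : int) : mx22 (zvar ^ m) 0 0 1 \in unitmx.
Proof.
by rewrite unitmxE det_mx22 unitfE mulr1 mul0r subr0 expfz_neq0 ?zvar_neq0.
Qed.

Definition diagz (m : int) : G := gl2_of (diagz_subproof m).

Fact Pimx_subproof (b : int) : mx22 1 zvar 0 (zvar ^ b) \in unitmx.
Proof.
by rewrite unitmxE det_mx22 unitfE mul1r mulr0 subr0 expfz_neq0 ?zvar_neq0.
Qed.

Definition Pimx (b : int) : G := gl2_of (Pimx_subproof b).

Section Convolution.
Variables (R : realType) (mu : {measure set G -> \bar R}).

(* Regularity is automatic: G is locally compact and second countable. *)
Definition left_haar : Prop :=
  [/\ forall (g : G) (A : set G), measurable A ->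
        mu [set (g * x)%g | x in A] = mu A,
      forall C : set G, compact C -> (mu C < +oo)%E
    & mu setT != 0%E].

Definition convolution (f g : G -> R) (x : G) : \bar R :=
  (\int[mu]_y (g ((y^-1 * x)%g) * f y)%:E)%E.

Definition hecke_c (m : int) : G -> R := \1_(double_coset Kgrp (diagz m) Kgrp).

Definition hecke_d (b : int) : G -> R := \1_(double_coset Kgrp (Pimx b) Hgrp).

(* The constant h_{ {-l}, {a} }^{ {b} }, for a, b > 1: outside this range Pimx
   is not the usual representative of the double coset indexed by b. *)
Definition struct_const (l a b : int) : \bar R :=
  convolution (hecke_c (- l)) (hecke_d b) (Pimx a).

End Convolution.
End StructureConstants.

Arguments zvar : clear implicits.
Arguments laurent_integral : clear implicits.
Arguments laurent_even : clear implicits.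
Arguments Kgrp : clear implicits.
Arguments Hgrp : clear implicits.

(* Main.v *)
(* The integrand of the convolution is the indicator function of a finite
   union of cosets y K, which are open and have measure 1, so the structure
   constant counts the cosets y K in K D K, D = diag(z^-l, 1), such that y^-1
   Pi^a lies in K Pi^b H. The cosets y K in K D K are indexed by the points
   [c : 1] and [1 : s], z | s, of the projective line over k[z]/(z^l), with
   representatives [[c,1],[1,0]] D and [[1,0],[s,1]] D. Row and column
   reduction puts y^-1 Pi^a in the double coset of b = a + l for the q^l
   points [c : 1], and of b = a + l - 2 v for [1 : s], where v is the
   valuation of s modulo z^l (v = l when s = 0). A parity argument on
   coefficients shows that the double cosets K Pi^b H, b >= 1, are pairwise
   disjoint; it remains to count the s of given valuation. *)
Require Import Defs.
From HB Require Import structures.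
From mathcomp Require Import all_boot all_order all_algebra.
From mathcomp Require Import all_classical all_reals all_analysis.
From mathcomp Require Import ring zify.
Import Order.TTheory GRing.Theory Num.Theory.
Local Open Scope classical_set_scope.
Local Open Scope ring_scope.

Set Implicit Arguments.
Unset Strict Implicit.
Unset Printing Implicit Defensive.

(** * Valuation bounds and leading coefficients in F((z)) *)

Section LaurentSeries.
Variable F : fieldType.
Local Notation L := (laurent F).
Implicit Types (f g : L) (m n : int).

Lemma lcoefB f g n : lcoef (f - g) n = lcoef f n - lcoef g n.
Proof. by []. Qed.

Lemma lcoefN f n : lcoef (- f) n = - lcoef f n.
Proof. by []. Qed.

Lemma lcoef1 n : lcoef (1 : L) n = (n == 0)%:R.
Proof. by []. Qed.

Lemma lcoefM f g n : lcoef (f * g) n = lmul_coef (lcoef f) (lcoef g) n.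
Proof. by []. Qed.

Lemma lcoef_lmonomM m f n : lcoef (lmonom F m * f) n = lcoef f (n - m).
Proof.
rewrite lcoefM /lmul_coef (@fsbigE _ _ _ _ _ [:: m]) //; last first.
  by move=> i _; rewrite inE /lcoef /= => /negbTE ->; rewrite mul0r.
by rewrite big_cons big_nil in_setT /= addr0 /lcoef /= eqxx mul1r.
Qed.

Lemma lmonomD m n : lmonom F (m + n) = lmonom F m * lmonom F n.
Proof.
apply: laurent_eqP => i; rewrite lcoef_lmonomM /lcoef /=.
by congr (_%:R); apply/eqP/eqP; lia.
Qed.

Lemma lmonomX m : lmonom F m = lmonom F 1 ^ m.
Proof.
have nat_case (n : nat) : lmonom F n%:Z = lmonom F 1 ^+ n.
  elim: n => [|n IHn]; first by rewrite expr0.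
  by rewrite exprS -IHn -lmonomD; congr (lmonom F _); lia.
case: m => n; first exact: nat_case.
have /mulr1_eq <- : lmonom F n.+1%:Z * lmonom F (Negz n) = 1.
  by rewrite -lmonomD NegzE subrr.
by rewrite nat_case NegzE -exprnN.
Qed.

(** A lower bound instead of a valuation, so that the series 0 needs no separate treatment. *)
Definition lval_ge m f := forall n, n < m -> lcoef f n = 0.

Lemma lval_geB m f g : lval_ge m f -> lval_ge m g -> lval_ge m (f - g).
Proof. by move=> fm gm n nm; rewrite lcoefB fm // gm // subr0. Qed.

Lemma lval_geN m f : lval_ge m f -> lval_ge m (- f).
Proof. by move=> fm; rewrite -sub0r; exact: lval_geB. Qed.

Lemma lval_geD m f g : lval_ge m f -> lval_ge m g -> lval_ge m (f + g).
Proof. by move=> fm gm n nm; rewrite lcoefD fm // gm // addr0. Qed.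

Lemma lval_geM m n f g : lval_ge m f -> lval_ge n g -> lval_ge (m + n) (f * g).
Proof. by move=> fm gn i imn; rewrite lcoefM (lmul_coef_lt fm gn). Qed.

Lemma lval_geW m n f : n <= m -> lval_ge m f -> lval_ge n f.
Proof. by move=> nm fm i iN; apply: fm; exact: lt_le_trans nm. Qed.

Lemma lval_ge_lmonomM m n f : lval_ge m f -> lval_ge (n + m) (lmonom F n * f).
Proof. by move=> fm i im; rewrite lcoef_lmonomM fm //; lia. Qed.

Lemma lval_ge_lmonom n : lval_ge n (lmonom F n).
Proof. by move=> i /lt_eqF; rewrite /lcoef /= => ->. Qed.

Lemma lcoefM_min m n f g : lval_ge m f -> lval_ge n g ->
  lcoef (f * g) (m + n) = lcoef f m * lcoef g n.
Proof.
move=> fm gn; have := lmul_coef_nat 0 fm gn.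
by rewrite addr0 big_ord1 !addr0 => <-.
Qed.

Lemma lcoefM0 f g : lval_ge 0 f -> lval_ge 0 g ->
  lcoef (f * g) 0 = lcoef f 0 * lcoef g 0.
Proof. by move=> f0 g0; rewrite -(lcoefM_min f0 g0) addr0. Qed.

(** Leading coefficients multiply: if f^-1 has order N, then f * f^-1 has a nonzero coefficient at
    N, while 1 has one only at 0. Hence N = 0. *)
Lemma lval_geV f : lval_ge 0 f -> lcoef f 0 != 0 -> lval_ge 0 f^-1.
Proof.
move=> f0 nz; have fn0 : f != 0 by apply: contraNneq nz => ->.
have /lorder[N [Nlt Nnz]] : f^-1 != 0 by rewrite invr_eq0.
have := lcoefM_min f0 Nlt; rewrite divff // add0r lcoef1.
case: eqP => [N0 _|_ /esym/eqP]; first by rewrite -N0.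
by rewrite mulf_eq0 (negbTE nz) (negbTE Nnz).
Qed.

Lemma lcoef_unit0 f : f != 0 -> lval_ge 0 f -> lval_ge 0 f^-1 ->
  lcoef f 0 != 0.
Proof.
move=> fn0 f0 fV0; have := lcoefM0 f0 fV0; rewrite divff // lcoef1 eqxx.
by apply: contra_eqN => /eqP ->; rewrite mul0r oner_eq0.
Qed.

Lemma lcoefV0 f : lval_ge 0 f -> lcoef f 0 != 0 ->
  lcoef f^-1 0 = (lcoef f 0)^-1.
Proof.
move=> f0 nz; have fn0 : f != 0 by apply: contraNneq nz => ->.
have := lcoefM0 f0 (lval_geV f0 nz); rewrite divff // lcoef1 eqxx => /esym.
by move/mulr1_eq.
Qed.

Fact lser_subproof (s : nat -> F) :
  (fun n : int => if n is Posz i then s i else 0) \in @laurent_pred F.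
Proof. by apply/asboolP; exists 0; case. Qed.

Definition lser (s : nat -> F) : L := laurent_of (lser_subproof s).

Lemma lser_ge0 s : lval_ge 0 (lser s).
Proof. by case. Qed.

Fact leven_part_subproof f :
  (fun n : int => if (2 %| n)%Z then lcoef f n else 0) \in @laurent_pred F.
Proof.
have [N fN] := lcoef_bound f.
by apply/asboolP; exists N => n /fN ->; rewrite if_same.
Qed.

Definition leven_part f : L := laurent_of (leven_part_subproof f).

Lemma lcoef_leven_part f n :
  lcoef (leven_part f) n = if (2 %| n)%Z then lcoef f n else 0.
Proof. by []. Qed.

End LaurentSeries.

(** * The subrings k[[z]] and k((z^2)) of k((z)) *)

Section Integral.
Variable k : finFieldType.
Local Notation L := (laurent k).
Implicit Types (f g : L) (m n : int).

Lemma zvarX m : zvar k ^ m = lmonom k m.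
Proof. by rewrite lmonomX. Qed.

Lemma lcoef_zvarM m f n : lcoef (zvar k ^ m * f) n = lcoef f (n - m).
Proof. by rewrite zvarX lcoef_lmonomM. Qed.

Lemma lval_ge_zvar m : lval_ge m (zvar k ^ m).
Proof. by rewrite zvarX; exact: lval_ge_lmonom. Qed.

Lemma leven_part_id f : laurent_even k f -> leven_part f = f.
Proof.
move=> fe; apply: laurent_eqP => n; rewrite lcoef_leven_part.
by case: ifPn => // /fe ->.
Qed.

Lemma leven_part_even f : laurent_even k (leven_part f).
Proof. by move=> n; rewrite lcoef_leven_part => /negbTE ->. Qed.

(** The projection onto even exponents is linear over k((z^2)): an even f shifts exponents without
    changing their parity. Closure of k((z^2)) under products and inverses follows from this. *)
Lemma leven_partM f g : laurent_even k f ->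
  leven_part (f * g) = f * leven_part g.
Proof.
move=> fe; apply: laurent_eqP => n; rewrite lcoef_leven_part !lcoefM.
case: ifPn => [ne|no].
  apply: eq_fsbigr => i _; rewrite lcoef_leven_part.
  case: ifPn => // nio; rewrite fe ?mul0r //.
  by apply: contra nio => ie; rewrite rpredB.
rewrite /lmul_coef fsbig1 // => i _; rewrite lcoef_leven_part.
case: ifPn => [nie|_]; last by rewrite mulr0.
rewrite fe ?mul0r //; apply: contra no => ie.
by rewrite -(subrK i n) rpredD.
Qed.

Lemma laurent_even1 : laurent_even k 1.
Proof. by move=> n no; rewrite lcoef1; case: eqP no => // ->. Qed.

Lemma laurent_evenB f g :
  laurent_even k f -> laurent_even k g -> laurent_even k (f - g).
Proof. by move=> fe ge n no; rewrite lcoefB fe // ge // subr0. Qed.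

Lemma laurent_evenM f g :
  laurent_even k f -> laurent_even k g -> laurent_even k (f * g).
Proof.
move=> fe ge; rewrite -(leven_part_id ge) -leven_partM //.
exact: leven_part_even.
Qed.

(** By linearity, f times the even part of f^-1 is the even part of 1, so f^-1 equals its own even
    part. *)
Lemma laurent_evenV f : laurent_even k f -> laurent_even k f^-1.
Proof.
have [-> _|f0 fe] := eqVneq f 0; first by rewrite invr0.
suff -> : f^-1 = leven_part f^-1 by exact: leven_part_even.
apply: (mulfI f0); rewrite -leven_partM // divff //.
by rewrite leven_part_id //; exact: laurent_even1.
Qed.

Lemma laurent_even_zvarX m : (2 %| m)%Z -> laurent_even k (zvar k ^ m).
Proof.
by move=> me n; rewrite zvarX /lcoef /=; case: eqP => // ->; rewrite me.
Qed.

Lemma laurent_integral1 : laurent_integral k 1.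
Proof. by move=> n n0; rewrite lcoef1 (lt_eqF n0). Qed.

Lemma laurent_integralM f g : laurent_integral k f -> laurent_integral k g ->
  laurent_integral k (f * g).
Proof. exact: lval_geM. Qed.

Lemma laurent_integral_zvarX m : 0 <= m -> laurent_integral k (zvar k ^ m).
Proof. by move=> m0; apply: (lval_geW m0); exact: lval_ge_zvar. Qed.

End Integral.

(** * The groups K and H, and the topology and measure of the cosets g K *)

Section GL2Theory.
Variable k : finFieldType.
Local Notation L := (laurent k).
Local Notation G := (GL2 k).
Implicit Types (f : L) (g h : G).

(** Common to k[[z]] and k((z^2)), so that the group laws of K and H are proved once. *)
Definition is_subring (A : set L) : Prop :=
  [/\ A 1, forall f f', A f -> A f' -> A (f - f')
    & forall f f', A f -> A f' -> A (f * f')].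

Lemma laurent_integral_subring : is_subring (laurent_integral k).
Proof.
split; [exact: laurent_integral1 | exact: lval_geB | exact: laurent_integralM].
Qed.

Lemma laurent_even_subring : is_subring (laurent_even k).
Proof.
split; [exact: laurent_even1 | exact: laurent_evenB | exact: laurent_evenM].
Qed.

Lemma ord2P (i : 'I_2) : i = 0 \/ i = 1.
Proof. by case: i => [[|[|//]]] i; [left|right]; apply: val_inj. Qed.

Lemma mx22_eta (A : 'M[L]_2) : A = mx22 (A 0 0) (A 0 1) (A 1 0) (A 1 1).
Proof.
by apply/matrixP => i j; rewrite mxE; case: (ord2P i) (ord2P j) => -> [] ->.
Qed.

Lemma mulmx2E (A B : 'M[L]_2) i j :
  (A *m B) i j = A i 0 * B 0 j + A i 1 * B 1 j.
Proof.
rewrite !mxE !big_ord_recl big_ord0 addr0 /=.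
by rewrite (_ : lift ord0 ord0 = 1) //; apply: val_inj.
Qed.

Lemma mulmx22 a b c d a' b' c' d' :
  mx22 a b c d *m mx22 a' b' c' d' =
  mx22 (a * a' + b * c') (a * b' + b * d') (c * a' + d * c') (c * b' + d * d')
  :> 'M[L]_2.
Proof.
apply/matrixP => i j; rewrite mulmx2E !mxE /=.
by case: (ord2P i) (ord2P j) => -> [] ->.
Qed.

Lemma det_mx2 (A : 'M[L]_2) : \det A = A 0 0 * A 1 1 - A 0 1 * A 1 0.
Proof. by rewrite {1}[A]mx22_eta det_mx22. Qed.

Lemma GL2_det_neq0 g : \det (val g) != 0.
Proof. by have := valP g; rewrite unitmxE unitfE. Qed.

Lemma val_GL2M g h : val (g * h)%g = val g *m val h.
Proof. by []. Qed.

Lemma val_GL2V g : val (g^-1)%g = invmx (val g).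
Proof. by []. Qed.

Lemma mulmx22V a b c d (D := a * d - b * c : L) : D != 0 ->
  mx22 a b c d *m mx22 (D^-1 * d) (- (D^-1 * b)) (- (D^-1 * c)) (D^-1 * a) =
  1%:M.
Proof.
move=> D0; rewrite mulmx22 [RHS]mx22_eta !mxE /= ?mulr1n ?mulr0n.
have DV : D^-1 * (a * d - b * c) = 1 by rewrite mulVf.
by congr mx22; [rewrite -DV| | |rewrite -DV]; ring.
Qed.

Lemma val_GL2V_mx22 g (D := \det (val g)) : val (g^-1)%g =
  mx22 (D^-1 * val g 1 1) (- (D^-1 * val g 0 1))
       (- (D^-1 * val g 1 0)) (D^-1 * val g 0 0).
Proof.
have D0 : D != 0 := GL2_det_neq0 g.
rewrite val_GL2V; set B := mx22 _ _ _ _.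
suff gB : val g *m B = 1%:M by rewrite -[RHS](mulKmx (valP g)) gB mulmx1.
have := @mulmx22V (val g 0 0) (val g 0 1) (val g 1 0) (val g 1 1).
by rewrite -det_mx2 -mx22_eta; exact.
Qed.

(** The inverse of det g is the determinant of g^-1; conversely, the adjugate formula writes the
    entries of g^-1 with those of g and (det g)^-1. *)
Lemma GL2_overP (A : set L) g : is_subring A ->
  GL2_over A g <-> (forall i j, A (val g i j)) /\ A (\det (val g))^-1.
Proof.
case=> A1 AB AM.
have A0 : A 0 by rewrite -(subrr 1); exact: AB.
have AN f : A f -> A (- f) by move=> Af; rewrite -sub0r; exact: AB.
split=> [Ag|[Ag AD] i j].
  split=> [i j|]; first by case: (Ag i j).
  rewrite -det_inv -val_GL2V det_mx2; apply: AB; apply: AM;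
  by [case: (Ag 0 0) | case: (Ag 1 1) | case: (Ag 0 1) | case: (Ag 1 0)].
split; first exact: Ag.
rewrite val_GL2V_mx22.
by case: (ord2P i) (ord2P j) => -> [] ->; rewrite mxE /=;
  [|apply: AN|apply: AN|]; apply: AM.
Qed.

(** A series is a unit of k[[z]] exactly when it is integral with nonzero constant term. Membership
    in K thus becomes a condition on finitely many coefficients, which is visibly open. *)
Lemma KgrpP g : Kgrp k g <->
  (forall i j, lval_ge 0 (val g i j)) /\ lcoef (\det (val g)) 0 != 0.
Proof.
rewrite /Kgrp GL2_overP; last exact: laurent_integral_subring.
have intD : (forall i j, lval_ge 0 (val g i j)) -> lval_ge 0 (\det (val g)).
  move=> gi; rewrite det_mx2.
  by apply: lval_geB; apply: laurent_integralM; apply: gi.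
split=> -[gi gD]; split=> //.
  by apply: lcoef_unit0 => //; [exact: GL2_det_neq0 | exact: intD].
by apply: lval_geV => //; exact: intD.
Qed.

Lemma HgrpP g : (forall i j, laurent_even k (val g i j)) -> Hgrp k g.
Proof.
move=> ge; apply/GL2_overP; first exact: laurent_even_subring.
split=> //; apply: laurent_evenV; rewrite det_mx2.
by apply: laurent_evenB; apply: laurent_evenM; apply: ge.
Qed.

Lemma GL2_over1 A : is_subring A -> GL2_over A (1%g : G).
Proof.
case=> A1 AB AM; have A0 : A 0 by rewrite -(subrr 1); exact: AB.
move=> i j; rewrite invg1 mxE.
by case: eqP => _; rewrite ?mulr1n ?mulr0n.
Qed.

Lemma GL2_overV A g : GL2_over A g -> GL2_over A (g^-1)%g.
Proof. by move=> Ag i j; have [] := Ag i j; rewrite invgK. Qed.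

Lemma GL2_overM A g h : is_subring A ->
  GL2_over A g -> GL2_over A h -> GL2_over A (g * h)%g.
Proof.
case=> A1 AB AM; have A0 : A 0 by rewrite -(subrr 1); exact: AB.
have AD f f' : A f -> A f' -> A (f + f').
  move=> Af Af'; rewrite -[f']opprK.
  by apply: (AB) => //; rewrite -sub0r; apply: AB.
move=> Ag Ah i j; rewrite invgM !val_GL2M !mulmx2E.
have AgE i' j' : A (val g i' j') by case: (Ag i' j').
have AhE i' j' : A (val h i' j') by case: (Ah i' j').
have AgV i' j' : A (val (g^-1)%g i' j') by case: (Ag i' j').
have AhV i' j' : A (val (h^-1)%g i' j') by case: (Ah i' j').
by split; apply: AD; apply: AM.
Qed.


(* Entries of N have valuation at least S, so the entries of N * M modulo z only
   depend on those of M modulo z ^ (1 - S). *)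
Lemma open_GL2_preimage (N : 'M[L]_2) :
  open [set M : 'M[L]_2 | (forall i j, lval_ge 0 ((N *m M) i j)) /\
                          lcoef (\det (N *m M)) 0 != 0].
Proof.
have [S NS] : exists S : int, forall i j, lval_ge S (N i j).
  have [S00 H00] := lcoef_bound (N 0 0); have [S01 H01] := lcoef_bound (N 0 1).
  have [S10 H10] := lcoef_bound (N 1 0); have [S11 H11] := lcoef_bound (N 1 1).
  exists (Order.min (Order.min S00 S01) (Order.min S10 S11)) => i j n.
  rewrite !lt_min => /andP[/andP[n00 n01] /andP[n10 n11]].
  by case: (ord2P i) (ord2P j) => -> [] ->;
    [apply: H00|apply: H01|apply: H10|apply: H11].
rewrite openE => M [intM detM]; rewrite /interior.
pose U i j : set L := [set f | lval_ge (1 - S) (f - M i j)].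
have Ub i j : nbhs (M i j) (U i j).
  apply: open_nbhs_nbhs; split; last by rewrite /U /= subrr.
  change (lopen (U i j)) => f Uf; exists (1 - S) => g fg n nS.
  by rewrite lcoefB fg // -lcoefB; exact: Uf.
exists U => // M' UM' /=.
have dM i j : lval_ge 1 ((N *m M') i j - (N *m M) i j).
  have -> : (N *m M') i j - (N *m M) i j =
      N i 0 * (M' 0 j - M 0 j) + N i 1 * (M' 1 j - M 1 j).
    by rewrite !mulmx2E; ring.
  apply: (@lval_geW _ (S + (1 - S))); first by rewrite subrKC.
  by apply: lval_geD; apply: lval_geM => //; exact: UM'.
have intM' i j : lval_ge 0 ((N *m M') i j).
  rewrite -(subrK ((N *m M) i j) ((N *m M') i j)).
  by apply: lval_geD => //; exact: lval_geW (dM i j).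
split=> //; suff -> : lcoef (\det (N *m M')) 0 = lcoef (\det (N *m M)) 0 by [].
have E i j : lcoef ((N *m M') i j) 0 = lcoef ((N *m M) i j) 0.
  by apply/eqP; rewrite -subr_eq0 -lcoefB dM.
by rewrite !det_mx2 !lcoefB !lcoefM0 // !E.
Qed.

Lemma lcoset_KgrpP g x :
  (exists2 h, Kgrp k h & (g * h)%g = x) <-> Kgrp k (g^-1 * x)%g.
Proof.
split=> [[h Kh <-]|Kgx]; first by rewrite mulKg.
by exists (g^-1 * x)%g => //; rewrite mulVKg.
Qed.

(** By [KgrpP], the coset is the preimage under [val] of the open set of [open_GL2_preimage] for N =
    g^-1. *)
Lemma open_lcoset_Kgrp g : open [set (g * x)%g | x in Kgrp k].
Proof.
have := @open_GL2_preimage (val (g^-1)%g); set B := [set _ | _] => Bo.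
exists B => //; apply/seteqP; split=> x /=.
  by move=> Bx; apply/lcoset_KgrpP/KgrpP; exact: Bx.
by move=> /lcoset_KgrpP/KgrpP.
Qed.

Lemma measurable_lcoset_Kgrp g : measurable [set (g * x)%g | x in Kgrp k].
Proof. by apply: sub_sigma_algebra; exact: open_lcoset_Kgrp. Qed.

Lemma measurable_Kgrp : measurable (Kgrp k).
Proof.
have -> : Kgrp k = [set (1 * x)%g | x in Kgrp k].
  by apply/seteqP; split=> x; [move=> Kx; exists x; rewrite ?mul1g|
    case=> y Ky <-; rewrite mul1g].
exact: measurable_lcoset_Kgrp.
Qed.

Lemma haar_lcoset_Kgrp (R : realType) (mu : {measure set G -> \bar R}) g :
  left_haar mu -> mu [set (g * x)%g | x in Kgrp k] = mu (Kgrp k).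
Proof. by case=> inv _ _; apply: inv; exact: measurable_Kgrp. Qed.

End GL2Theory.

(** Turns a common point of two double cosets into an intertwining relation between their
    representatives. *)
Lemma mulg_transfer (gT : groupType) (a x b a' x' b' : gT) :
  (a * x * b = a' * x' * b' -> x * (b * b'^-1) = a^-1 * a' * x')%g.
Proof.
move=> E; apply: (mulgI a); apply: (mulIg b').
by rewrite !mulgA mulgVK E mulgV mul1g.
Qed.

(** * The double cosets K Pi^b H: membership criteria and disjointness *)

Section DoubleCosets.
Variable k : finFieldType.
Local Notation L := (laurent k).
Local Notation G := (GL2 k).
Local Notation K := (Kgrp k).
Local Notation H := (Hgrp k).
Local Notation z := (zvar k).
Local Notation KH x := (double_coset K x H).
Implicit Types (f : L) (g h x y : G) (m n v : int).

Lemma lcoef_zM f n : lcoef (z * f) n = lcoef f (n - 1).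
Proof. exact: lcoef_lmonomM. Qed.

Lemma lcoef_Mz f n : lcoef (f * z) n = lcoef f (n - 1).
Proof. by rewrite mulrC lcoef_zM. Qed.

Lemma lcoef_MzvarX m f n : lcoef (f * z ^ m) n = lcoef f (n - m).
Proof. by rewrite mulrC lcoef_zvarM. Qed.

Lemma zvarXD m n : z ^ (m + n) = z ^ m * z ^ n.
Proof. by rewrite expfzDr ?zvar_neq0. Qed.

Lemma zvarXB m n : z ^ (m - n) = z ^ m / z ^ n.
Proof. by rewrite zvarXD invr_expz. Qed.

Lemma zvarX_neq0 m : z ^ m != 0.
Proof. by rewrite expfz_neq0 ?zvar_neq0. Qed.

Lemma double_coset_trans x y g : KH x y -> KH y g -> KH x g.
Proof.
case=> [k1 Kk1 [h1 Hh1 <-]] [k2 Kk2 [h2 Hh2 <-]].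
exists (k2 * k1)%g; first exact: GL2_overM (laurent_integral_subring k) Kk2 Kk1.
exists (h1 * h2)%g; first exact: GL2_overM (laurent_even_subring k) Hh1 Hh2.
by rewrite !mulgA.
Qed.

Definition gl2 (a b c d : L) (u : a * d - b * c != 0 :> L) : G.
Proof.
by apply: (@gl2_of _ (mx22 a b c d)); rewrite unitmxE det_mx22 unitfE.
Defined.

Lemma val_gl2 (a b c d : L) (u : a * d - b * c != 0 :> L) :
  val (gl2 u) = mx22 a b c d.
Proof. by []. Qed.

Lemma Kgrp_mx22 g (a b c d : L) : val g = mx22 a b c d ->
  lval_ge 0 a -> lval_ge 0 b -> lval_ge 0 c -> lval_ge 0 d ->
  lcoef (a * d - b * c) 0 != 0 -> K g.
Proof.
move=> gE ga gb gc gd nz; apply/KgrpP; rewrite gE det_mx22; split=> // i j.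
by case: (ord2P i) (ord2P j) => -> [] ->; rewrite mxE.
Qed.

(** Certifies membership by explicit row operations over k[[z]] and column operations over
    k((z^2)). *)
Lemma double_coset_mx22 x g (a b c d a' b' c' d' : L) :
  lval_ge 0 a -> lval_ge 0 b -> lval_ge 0 c -> lval_ge 0 d ->
  lcoef (a * d - b * c) 0 != 0 ->
  laurent_even k a' -> laurent_even k b' -> laurent_even k c' ->
  laurent_even k d' -> a' * d' - b' * c' != 0 ->
  val g = mx22 a b c d *m val x *m mx22 a' b' c' d' -> KH x g.
Proof.
move=> ga gb gc gd nz ea eb ec ed nz' gE.
have nz0 : a * d - b * c != 0 by apply: contraNneq nz => ->.
exists (gl2 nz0); first exact: Kgrp_mx22 (val_gl2 _) ga gb gc gd nz.
exists (gl2 nz'); last by apply: val_inj.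
apply: HgrpP => i j; rewrite val_gl2.
by case: (ord2P i) (ord2P j) => -> [] ->; rewrite mxE.
Qed.

(** The even part e of p is removed by a column operation over k((z^2)). What is left is z u, with u
    even and a unit of k[[z]]; it is absorbed by scaling the second column by u and the second row
    by u^-1. *)
Lemma double_coset_Pimx g (b : int) (p : L) :
  val g = mx22 1 p 0 (z ^ b) -> lval_ge 0 p -> lcoef p 1 != 0 ->
  KH (Pimx k b) g.
Proof.
move=> gE p0 p1; pose e := leven_part p; pose u := z ^ (-1) * (p - e).
have uE n : lcoef u n = lcoef p (n + 1) - lcoef e (n + 1).
  by rewrite lcoef_zvarM lcoefB opprK.
have uint : lval_ge 0 u.
  move=> n n0; rewrite uE lcoef_leven_part; case: ifPn => [_|no].
    by rewrite subrr.
  by rewrite subr0 p0 //; move: no; lia.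
have u0 : lcoef u 0 != 0 by rewrite uE lcoef_leven_part subr0.
have ue : laurent_even k u.
  move=> n no; rewrite uE lcoef_leven_part ifT ?subrr //.
  by move: no; lia.
have un0 : u != 0 by apply: contraNneq u0 => ->.
have ge1 : lval_ge 0 (1 : L) := @laurent_integral1 k.
have pE : p = e + z * u.
  by rewrite /u exprN1 mulrA divff ?zvar_neq0 // mul1r addrC subrK.
apply: (@double_coset_mx22 _ _ 1 0 0 u^-1 1 e 0 u) => //.
- exact: lval_geV.
- by rewrite mul0r subr0 mul1r lcoefV0 // invr_eq0.
- exact: laurent_even1.
- exact: leven_part_even.
- by rewrite mulr0 subr0 mul1r.
- by rewrite gE !mulmx22 pE; congr mx22; field.
Qed.

(** Here g is z^v times an upper triangular matrix treated by [double_coset_Pimx]; the work is to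
    absorb the scalar, which lies in H only for even v. *)
Lemma double_coset_Pimx_scaled g (b v : int) (p : L) :
  val g = mx22 (z ^ v) (z ^ v * z * p) 0 (z ^ b * z ^ v) -> 1 <= b ->
  lval_ge 0 p -> lcoef p 0 != 0 -> KH (Pimx k b) g.
Proof.
move=> gE b1 pint p0.
have pn0 : p != 0 by apply: contraNneq p0 => ->.
have bn0 : z ^ b != 0 := zvarX_neq0 b.
have vn0 : z ^ v != 0 := zvarX_neq0 v.
have zn0 : z != 0 := zvar_neq0 k.
have ge1 : lval_ge 0 (1 : L) := @laurent_integral1 k.
have zint f : lval_ge 0 f -> lval_ge 0 (z * f).
  by move=> f0; apply: (@lval_geW _ (1 + 0)) => //; exact: lval_ge_lmonomM.
have nz q : 1 * z ^ b - (z * q) * 0 != 0 by rewrite mulr0 subr0 mul1r.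
have mid q : lval_ge 0 q -> lcoef q 0 != 0 -> KH (Pimx k b) (gl2 (nz q)).
  move=> qint q0; apply: (double_coset_Pimx (val_gl2 _)); first exact: zint.
  by rewrite lcoef_zM.
have [ve|vo] := boolP (2 %| v)%Z.
  apply: double_coset_trans (mid p pint p0) _.
  apply: (@double_coset_mx22 _ _ 1 0 0 1 (z ^ v) 0 0 (z ^ v)) => //.
  - by rewrite mul0r subr0 mul1r lcoef1 oner_neq0.
  - exact: laurent_even_zvarX.
  - exact: laurent_even_zvarX.
  - by rewrite mul0r subr0 mulf_neq0.
  - by rewrite gE !mulmx22; congr mx22; ring.
(* For odd v, the antidiagonal matrix with entries z^(v+1) and z^(v-1) does lie in H. It swaps the
   columns, which replaces p by p^-1; the row operation with entry z^(b-1) is integral since b >=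
   1. *)
have pVint := lval_geV pint p0.
have pV0 : lcoef p^-1 0 != 0 by rewrite lcoefV0 // invr_eq0.
apply: double_coset_trans (mid p^-1 pVint pV0) _.
apply: (@double_coset_mx22 _ _ p 0 (z ^ (b - 1)) (- p^-1)
          0 (z ^ (v + 1)) (z ^ (v - 1)) 0) => //.
- by apply: laurent_integral_zvarX; lia.
- exact: lval_geN.
- by rewrite mul0r subr0 mulrN divff // lcoefN lcoef1 oppr_eq0 oner_eq0.
- by apply: laurent_even_zvarX; move: vo; lia.
- by apply: laurent_even_zvarX; move: vo; lia.
- by rewrite mul0r sub0r oppr_eq0 mulf_neq0 ?zvarX_neq0.
- rewrite gE !mulmx22 !zvarXB zvarXD expr1z.
  by congr mx22; field; do ?[apply/andP; split].
Qed.

(* The relations below say [x * Pimx b = Pimx b' * y] entrywise, for x integral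
   and y even; they force the first column of x to vanish modulo z. *)
Lemma Pimx_intertwiner (b b' : int) (x00 x01 x10 x11 y00 y01 y10 y11 : L) :
  1 <= b' -> b' < b -> lval_ge 0 x01 -> lval_ge 0 x11 ->
  laurent_even k y01 -> laurent_even k y10 -> laurent_even k y11 ->
  x00 = y00 + z * y10 -> x00 * z + x01 * z ^ b = y01 + z * y11 ->
  x10 = z ^ b' * y10 -> x10 * z + x11 * z ^ b = z ^ b' * y11 ->
  lcoef x00 0 = 0 /\ lcoef x10 0 = 0.
Proof.
move=> b'1 b'b ix01 ix11 ey01 ey10 ey11 e00 e01 e10 e11.
(* Below degree b the term x11 * z^b drops out of the last relation. *)
have x10E n : n < b -> lcoef x10 (n - 1) = lcoef y11 (n - b').
  move=> nb; rewrite -(lcoef_zvarM b') -e11 lcoefD lcoef_Mz lcoef_MzvarX.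
  by rewrite ix11 ?addr0 //; lia.
(* At n = b' this coefficient equals that of y10 at the odd index -1. *)
have y11_0 : lcoef y11 0 = 0.
  by rewrite -(subrr b') -x10E // e10 lcoef_zvarM addrAC subrr ey10.
split.
  have := congr1 (fun f => lcoef f 1) e01.
  rewrite /= !lcoefD lcoef_zM lcoef_Mz lcoef_MzvarX subrr y11_0.
  by rewrite ix01 ?ey01 ?addr0 //; lia.
(* The constant term of x10 is both the coefficient of y11 at 1 - b' and that of y10 at - b'; one of
   these indices is odd. *)
have [b'e|b'o] := boolP (2 %| b')%Z.
  have := x10E 1; rewrite subrr => -> //; last lia.
  by rewrite ey11 //; move: b'e; lia.
by rewrite e10 lcoef_zvarM sub0r ey10 // rpredN.
Qed.

(** A common point gives x in K and y in H intertwining the two representatives. The first column of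
    x is then zero modulo z, against det x being a unit. *)
Lemma Pimx_double_coset_lt (b b' : int) g : 1 <= b' -> b' < b ->
  KH (Pimx k b) g -> KH (Pimx k b') g -> False.
Proof.
move=> b'1 b'b [k1 Kk1 [h1 Hh1 <-]] [k2 Kk2 [h2 Hh2 E]].
pose x := (k2^-1 * k1)%g; pose y := (h2 * h1^-1)%g.
have /KgrpP[xint xdet] : K x.
  apply: GL2_overM (laurent_integral_subring k) _ Kk1; exact: GL2_overV.
have ye i j : laurent_even k (val y i j).
  have : H y.
    apply: GL2_overM (laurent_even_subring k) Hh2 _; exact: GL2_overV.
  by move=> /(_ i j)[].
have {}E : (x * Pimx k b)%g = (Pimx k b' * y)%g.
  exact/esym/mulg_transfer.
have e i j : (val x *m mx22 1 z 0 (z ^ b)) i j =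
             (mx22 1 z 0 (z ^ b') *m val y) i j.
  by have := congr1 (fun g => val g i j) E.
have e00 : val x 0 0 = val y 0 0 + z * val y 1 0.
  by have := e 0 0; rewrite !mulmx2E !mxE /= mulr1 mulr0 mul1r addr0.
have e01 : val x 0 0 * z + val x 0 1 * z ^ b = val y 0 1 + z * val y 1 1.
  by have := e 0 1; rewrite !mulmx2E !mxE /= mul1r.
have e10 : val x 1 0 = z ^ b' * val y 1 0.
  by have := e 1 0; rewrite !mulmx2E !mxE /= mulr1 mulr0 mul0r addr0 add0r.
have e11 : val x 1 0 * z + val x 1 1 * z ^ b = z ^ b' * val y 1 1.
  by have := e 1 1; rewrite !mulmx2E !mxE /= mul0r add0r.
have [x00 x10] := Pimx_intertwiner b'1 b'b (xint 0 1) (xint 1 1) (ye 0 1)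
  (ye 1 0) (ye 1 1) e00 e01 e10 e11.
move: xdet; rewrite det_mx2 lcoefB !lcoefM0 // x00 x10 mul0r mulr0 subrr.
by rewrite eqxx.
Qed.

Lemma Pimx_double_coset_inj (b b' : int) g : 1 <= b -> 1 <= b' ->
  KH (Pimx k b) g -> KH (Pimx k b') g -> b = b'.
Proof.
move=> b1 b'1 gb gb'; case: (ltgtP b b') => // lt.
- by case: (Pimx_double_coset_lt b1 lt gb' gb).
- by case: (Pimx_double_coset_lt b'1 lt gb gb').
Qed.

End DoubleCosets.

(** * The cosets y K in K D K, and the double coset of y^-1 Pi^a *)

Section Representatives.
Variables (k : finFieldType) (n : nat).
Local Notation L := (laurent k).
Local Notation G := (GL2 k).
Local Notation K := (Kgrp k).
Local Notation H := (Hgrp k).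
Local Notation z := (zvar k).
Local Notation l := (n.+1%:Z).
Local Notation D := (diagz k (- l)).
Local Notation KH x := (double_coset K x H).

(* The projective line over k[z]/(z^l): inl c stands for [c : 1] and inr t for
   [1 : z t]. *)
Definition P1 : finType := ({ffun 'I_n.+1 -> k} + {ffun 'I_n -> k})%type.
Implicit Types (u : P1).

Definition trunc_ser m (t : {ffun 'I_m -> k}) : L := lser (nth 0 (codom t)).

Lemma lcoef_trunc_ser m (t : {ffun 'I_m -> k}) (i : 'I_m) :
  lcoef (trunc_ser t) i%:Z = t i.
Proof. by rewrite /lcoef /= codom_ffun nth_fgraph_ord. Qed.

Lemma trunc_ser_ge0 m (t : {ffun 'I_m -> k}) : lval_ge 0 (trunc_ser t).
Proof. exact: lser_ge0. Qed.

Lemma lval_ge_trunc_serB m (f : L) : lval_ge 0 f ->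
  lval_ge m%:Z (f - trunc_ser [ffun i : 'I_m => lcoef f i%:Z]).
Proof.
move=> f0 [i im|i _]; last by rewrite lcoefB f0 // trunc_ser_ge0 // subrr.
have im' : (i < m)%N by rewrite -ltz_nat.
by rewrite lcoefB -[i]/(val (Ordinal im')) lcoef_trunc_ser ffunE subrr.
Qed.

(** The linear form whose vanishing modulo z^l says that [f : g] is the point u. *)
Definition P1_pair u (f g : L) : L :=
  match u with
  | inl c => f - trunc_ser c * g
  | inr t => g - z * trunc_ser t * f
  end.

Definition P1_mx u : 'M[L]_2 :=
  match u with
  | inl c => mx22 (trunc_ser c) 1 1 0
  | inr t => mx22 1 0 (z * trunc_ser t) 1
  end.

Fact P1_mx_subproof u : P1_mx u \in unitmx.
Proof.
rewrite unitmxE; case: u => t /=; rewrite det_mx22.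
  by rewrite mulr0 mul1r sub0r unitrN1.
by rewrite mul0r mulr1 subr0 unitr1.
Qed.

Definition P1_gl2 u : G := gl2_of (P1_mx_subproof u).
Definition rep u : G := (P1_gl2 u * D)%g.

Lemma z_trunc_ge1 m (t : {ffun 'I_m -> k}) : lval_ge 1 (z * trunc_ser t).
Proof. by have := @lval_ge_lmonomM k 0 1 _ (@trunc_ser_ge0 _ t). Qed.

Lemma Kgrp_P1_gl2 u : K (P1_gl2 u).
Proof.
have ge1 : lval_ge 0 (1 : L) := @laurent_integral1 k.
case: u => t.
  apply: (@Kgrp_mx22 _ _ (trunc_ser t) 1 1 0) => //; first exact: trunc_ser_ge0.
  rewrite mulr0 mul1r sub0r.
  by rewrite lcoefN lcoef1 oppr_eq0 oner_eq0.
apply: (@Kgrp_mx22 _ _ 1 0 (z * trunc_ser t) 1) => //.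
  exact: lval_geW (@z_trunc_ge1 _ t).
by rewrite mul0r subr0 mulr1 lcoef1 oner_eq0.
Qed.

Lemma P1_gl2V_10 u (x : G) :
  val ((P1_gl2 u)^-1 * x)%g 1 0 = P1_pair u (val x 0 0) (val x 1 0).
Proof.
set y := (_ * x)%g; have -> : x = (P1_gl2 u * y)%g by rewrite mulVKg.
rewrite val_GL2M !mulmx2E; move: (val y 0 0) (val y 1 0) => f g.
by case: u {y} => t /=; rewrite !mxE /=; ring.
Qed.

Lemma val_conj_diagz (x : G) : val (D^-1 * x * D)%g =
  mx22 (val x 0 0) (z ^ l * val x 0 1) (z ^ (- l) * val x 1 0) (val x 1 1).
Proof.
have zl : z ^ l * z ^ (- l) = 1 by rewrite -zvarXD subrr expr0z.
have nz : val x 0 0 * val x 1 1 -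
    (z ^ l * val x 0 1) * (z ^ (- l) * val x 1 0) != 0.
  rewrite mulrACA zl mul1r -det_mx2; exact: GL2_det_neq0.
rewrite -(val_gl2 nz); congr val; rewrite -mulgA.
suff -> : (x * D = D * gl2 nz)%g by rewrite mulKg.
apply: val_inj; rewrite !val_GL2M /= {1}[val x]mx22_eta !mulmx22.
move: zl; move: (val x 0 0) (val x 0 1) (val x 1 0) (val x 1 1).
move: (z ^ l) (z ^ (- l)) => Z Z' x00 x01 x10 x11 ZZ'; congr mx22; try ring.
by rewrite !mul0r addr0 mulr0 mulr1 add0r mulrA [Z' * Z]mulrC ZZ' mul1r.
Qed.

(** Conjugation by D keeps the determinant, multiplies the upper right entry by z^l and divides the
    lower left one by z^l; only the latter can leave k[[z]]. *)
Lemma Kgrp_conj_diagz (x : G) : K x ->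
  K (D^-1 * x * D)%g <-> lval_ge l (val x 1 0).
Proof.
move=> /KgrpP[xint xdet]; split=> [/KgrpP[/(_ 1 0)]|x10].
  rewrite val_conj_diagz mxE /= => ge0 _ i il.
  have := ge0 (i - l); rewrite lcoef_zvarM opprK subrK; apply; lia.
have zl : z ^ l * z ^ (- l) = 1 by rewrite -zvarXD subrr expr0z.
apply: (Kgrp_mx22 (val_conj_diagz x)) => //.
- apply: (@lval_geW _ (l + 0)); first lia.
  by apply: lval_geM => //; exact: lval_ge_zvar.
- rewrite -[0](addNr l).
  by apply: lval_geM => //; exact: lval_ge_zvar.
- by rewrite mulrACA zl mul1r -det_mx2.
Qed.

(** The coset of x D y depends only on the first column of x, read as a point of the projective line
    modulo z^l. *)
Lemma rep_lcoset u (x y : G) : K x -> K y ->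
  K ((rep u)^-1 * (x * D * y))%g <->
  lval_ge l (P1_pair u (val x 0 0) (val x 1 0)).
Proof.
move=> Kx Ky; rewrite -P1_gl2V_10 -Kgrp_conj_diagz; last first.
  apply: GL2_overM (laurent_integral_subring k) _ Kx.
  exact: GL2_overV (Kgrp_P1_gl2 u).
have -> : ((rep u)^-1 * (x * D * y) = D^-1 * ((P1_gl2 u)^-1 * x) * D * y)%g.
  by rewrite /rep invgM !mulgA.
split=> Kz; last exact: GL2_overM (laurent_integral_subring k) Kz Ky.
rewrite -[X in K X](mulgK y).
by apply: GL2_overM (laurent_integral_subring k) Kz _; exact: GL2_overV.
Qed.

(** By [rep_lcoset], the first column of [P1_gl2 u'] represents the point u. Within one chart the
    truncated coefficients then agree; between the two charts, 1 would be congruent modulo z^l to a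
    multiple of z. *)
Lemma rep_inj u u' (x x' : G) : K x -> K x' ->
  (rep u * x = rep u' * x')%g -> u = u'.
Proof.
move=> Kx Kx' E.
have : K ((rep u)^-1 * (P1_gl2 u' * D * x'))%g by rewrite -/(rep u') -E mulKg.
rewrite rep_lcoset //; last exact: Kgrp_P1_gl2.
have trunc_inj m (c c' : {ffun 'I_m -> k}) :
    lval_ge m (trunc_ser c' - trunc_ser c) -> c = c'.
  move=> ge; apply/ffunP => i; apply/eqP.
  rewrite eq_sym -subr_eq0 -!lcoef_trunc_ser -lcoefB ge //.
  by rewrite ltz_nat.
have coprime_absurd m m' (c : {ffun 'I_m -> k}) (t : {ffun 'I_m' -> k}) :
    lval_ge l (1 - trunc_ser c * (z * trunc_ser t)) -> False.
  move=> /(_ 0 isT); rewrite lcoefB lcoef1 lcoefM0; last 2 first.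
  - exact: trunc_ser_ge0.
  - exact: lval_geW (@z_trunc_ge1 _ t).
  by rewrite (z_trunc_ge1 t) // mulr0 subr0 => /eqP; rewrite oner_eq0.
case: u u' {E} => [c|t] [c'|t'] /=; rewrite !mxE /=.
- by rewrite mulr1 => /trunc_inj ->.
- by move=> /coprime_absurd.
- by rewrite mulrC => /coprime_absurd.
(* Dividing by z lowers the precision from l to n, exactly the number of coefficients of t. *)
- rewrite mulr1 -mulrBr => ge; congr inr; apply: trunc_inj => i im.
  by have := ge (i + 1); rewrite lcoef_zM addrK; apply; lia.
Qed.

(** The chart is chosen by which coordinate is a unit: f / g is truncated if g is one; otherwise g /
    f is divisible by z and its quotient by z is truncated. *)
Lemma P1_pair_exists (f g : L) : lval_ge 0 f -> lval_ge 0 g ->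
  (lcoef f 0 != 0) || (lcoef g 0 != 0) ->
  exists u : P1, lval_ge l (P1_pair u f g).
Proof.
move=> f0 g0; have [g00|g00] /= := boolP (lcoef g 0 != 0).
  move=> _; have gn0 : g != 0 by apply: contraNneq g00 => ->.
  have q0 : lval_ge 0 (f / g).
    by apply: laurent_integralM => //; exact: lval_geV.
  exists (inl [ffun i : 'I_n.+1 => lcoef (f / g) i%:Z]) => /=.
  rewrite -[X in X - _](divfK gn0) -mulrBl -[l]addr0.
  by apply: lval_geM => //; exact: lval_ge_trunc_serB.
rewrite orbF => f00; have fn0 : f != 0 by apply: contraNneq f00 => ->.
have q0 : lval_ge 0 (g / f) by apply: laurent_integralM => //; exact: lval_geV.
have q00 : lcoef (g / f) 0 = 0.
  rewrite lcoefM0 //; last exact: lval_geV.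
  by rewrite (eqP (negPn g00)) mul0r.
pose q := lmonom k (-1) * (g / f).
have zq : g / f = z * q by rewrite /q mulrA -lmonomD subrr mul1r.
have qint : lval_ge 0 q.
  move=> i i0; rewrite lcoef_lmonomM opprK.
  have [->|i1] := eqVneq i (-1); first by rewrite addNr.
  by apply: q0; lia.
exists (inr [ffun i : 'I_n => lcoef q i%:Z]) => /=.
rewrite -[X in X - _](divfK fn0) zq -mulrBl -mulrBr.
rewrite (_ : l = 1 + n%:Z + 0); last by lia.
apply: lval_geM => //; apply: lval_ge_lmonomM; exact: lval_ge_trunc_serB.
Qed.

(** The first column of x in K is nonzero modulo z because det x is a unit, so it defines a point u,
    and x D x' lies in the coset of [rep u]. *)
Lemma KDK_rep (y : G) : double_coset K D K y <->
  exists u : P1, exists2 x, K x & (rep u * x)%g = y.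
Proof.
split=> [[x Kx [x' Kx' <-]]|[u [x Kx <-]]]; last first.
  by exists (P1_gl2 u); [exact: Kgrp_P1_gl2 | exists x].
have /KgrpP[xint xdet] := Kx.
have [//|//||u uP] := @P1_pair_exists (val x 0 0) (val x 1 0).
  rewrite -negb_and; apply: contra xdet => /andP[/eqP x00 /eqP x10].
  by rewrite det_mx2 lcoefB !lcoefM0 // x00 x10 mul0r mulr0 subrr.
by exists u; apply/lcoset_KgrpP/rep_lcoset.
Qed.

(** The valuation of [trunc_ser t], with value m for t = 0, as [find] returns the length when
    nothing is found. *)
Definition lead_idx m (t : {ffun 'I_m -> k}) : nat :=
  find (fun c => c != 0) (codom t).

(** The successor accounts for the factor z in s = z t; for t = 0 it makes v = n + 1 = l. *)
Definition rep_class (a : int) (u : P1) : int :=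
  match u with
  | inl _ => a + l
  | inr t => a + l - 2 * (lead_idx t).+1%:Z
  end.

Lemma trunc_ser_lead m (t : {ffun 'I_m -> k})
    (i := lead_idx t) : (i < m)%N ->
  exists w : L, [/\ trunc_ser t = z ^ i%:Z * w, lval_ge 0 w & lcoef w 0 != 0].
Proof.
move=> im; exists (lser (fun j => nth 0 (codom t) (i + j))); split.
- apply: laurent_eqP => j; rewrite lcoef_zvarM.
  have [ji|] := ltP j i%:Z.
    rewrite [RHS]lser_ge0; last lia.
    case: j ji => [j|j //]; rewrite ltz_nat => ji; apply/eqP/negbFE.
    exact: (@before_find _ 0 (fun c => c != 0)).
  case: j => // j; rewrite lez_nat => ij; rewrite subzn // /lcoef /=.
  by rewrite subnKC.
- exact: lser_ge0.
- rewrite /lcoef /= addn0; apply: (nth_find 0 (a := fun c => c != 0)).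
  by rewrite has_find size_codom card_ord.
Qed.

Lemma trunc_ser_eq0 m (t : {ffun 'I_m -> k}) :
  lead_idx t = m -> trunc_ser t = 0.
Proof.
move=> tm; apply: laurent_eqP => -[i|i] //; rewrite lcoef0 /lcoef /=.
have [im|im] := ltnP i m.
  apply/eqP/negbFE; apply: (@before_find _ 0 (fun c => c != 0)).
  by rewrite -/(lead_idx t) tm.
by rewrite nth_default // size_codom card_ord.
Qed.

Lemma lead_idx_le m (t : {ffun 'I_m -> k}) : (lead_idx t <= m)%N.
Proof. by rewrite -[leqRHS]card_ord -(size_codom t) find_size. Qed.

Lemma rep_class_ge a u : a - l <= rep_class a u.
Proof.
case: u => [c|t] /=; first lia.
by move: (lead_idx t) (lead_idx_le t) => i; lia.
Qed.

Lemma repV_Pimx_double_coset (a : int) (u : P1) : l < a - 1 ->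
  KH (Pimx k (rep_class a u)) ((rep u)^-1 * Pimx k a)%g.
Proof.
move=> la; have zn0 : z != 0 := zvar_neq0 k.
have ge1 : lval_ge 0 (1 : L) := @laurent_integral1 k.
have cls1 : 1 <= rep_class a u by apply: le_trans (rep_class_ge a u); lia.
have zl : z ^ (- l) * z ^ l = 1 by rewrite -zvarXD addNr expr0z.
have repV (w : G) : Pimx k a = (rep u * w)%g -> ((rep u)^-1 * Pimx k a)%g = w.
  by move=> ->; rewrite mulKg.
have unit_near1 (f : L) :
    lval_ge 1 f -> lval_ge 0 (1 - f) /\ lcoef (1 - f) 0 != 0.
  move=> f1; split; first by apply: lval_geB => //; exact: (@lval_geW _ 1).
  by rewrite lcoefB lcoef1 f1 // subr0 oner_eq0.
case: u cls1 repV => [c|t] /= cls1 repV.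
  (* Here (rep u)^-1 Pi^a is [[0, z^(a+l)], [1, z - s z^a]]. Swapping its rows gives the scaled form
     with v = 0 and p = 1 - s z^(a-1), a unit since a > 1. *)
  pose s := trunc_ser c.
  have nz : 0 * (z - s * z ^ a) - z ^ (a + l) * 1 != 0.
    by rewrite mul0r mulr1 sub0r oppr_eq0 zvarX_neq0.
  rewrite (repV (gl2 nz)); last first.
    apply: val_inj; rewrite /rep !val_GL2M /= !mulmx22 -/s zvarXD.
    move: zl; move: (z ^ (- l)) (z ^ l) (z ^ a) => Z' Z A ZZ'.
    by congr mx22; rewrite ?ZZ'; try ring; ring: ZZ'.
  have nz' : z ^ 0 * (z ^ (a + l) * z ^ 0) -
      (z ^ 0 * z * (1 - s * z ^ (a - 1))) * 0 != 0.
    by rewrite mulr0 subr0 !mulf_neq0 ?zvarX_neq0.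
  have [|p0 p1] := unit_near1 (s * z ^ (a - 1)).
    rewrite -[1]add0r; apply: lval_geM; first exact: trunc_ser_ge0.
    by apply: lval_geW (@lval_ge_zvar k (a - 1)); lia.
  have := double_coset_Pimx_scaled (val_gl2 nz') cls1 p0 p1.
  move/double_coset_trans; apply.
  apply: (@double_coset_mx22 _ _ _ 0 1 1 0 1 0 0 1) => //.
  - by rewrite mul0r mul1r sub0r lcoefN lcoef1 oppr_eq0 oner_eq0.
  - exact: laurent_even1.
  - exact: laurent_even1.
  - by rewrite mulr1 mulr0 subr0 oner_eq0.
  - rewrite /= !mulmx22 zvarXB expr1z expr0z.
    by move: (z ^ (a + l)) (z ^ a) => Z A; congr mx22; field.
(* Here (rep u)^-1 Pi^a is [[z^l, z^(l+1)], [-s, z^a - s z]]. *)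
pose s := z * trunc_ser t; pose i := lead_idx t.
have nz : z ^ l * (z ^ a - s * z) - z ^ l * z * - s != 0.
  rewrite (_ : _ - _ = z ^ l * z ^ a); last by ring.
  by rewrite mulf_neq0 ?zvarX_neq0.
rewrite (repV (gl2 nz)); last first.
  apply: val_inj; rewrite /rep !val_GL2M /= !mulmx22 -/s.
  move: zl; move: (z ^ (- l)) (z ^ l) (z ^ a) => Z' Z A ZZ'.
  by congr mx22; try ring; ring: ZZ'.
have [im|] := ltnP (lead_idx t) n; last first.
  (* For s = 0 the matrix is already in scaled form, with v = l and p = 1. *)
  move=> ni; have tn : lead_idx t = n.
    by apply/eqP; rewrite eqn_leq ni lead_idx_le.
  have s0 : s = 0 by rewrite /s trunc_ser_eq0 // mulr0.
  have clsE : rep_class a (inr t) = a - l by rewrite /= tn; lia.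
  have zE : z ^ (rep_class a (inr t)) * z ^ l = z ^ a.
    by rewrite clsE -zvarXD subrK.
  apply: (@double_coset_Pimx_scaled _ _ _ l 1) => //.
    rewrite /= zE s0; congr mx22; rewrite ?oppr0 ?mul0r ?subr0 //; ring.
  by rewrite lcoef1 oner_eq0.
have [w [tw w0 w00]] := trunc_ser_lead im.
have wn0 : w != 0 by apply: contraNneq w00 => ->.
pose v := i.+1%:Z; have vl : v <= n%:Z by [].
have sE : s = z ^ v * w by rewrite /s tw mulrA -{1}[z]expr1z -zvarXD.
have clsE : rep_class a (inr t) = a + l - 2 * v by [].
have [|p0 p1] := unit_near1 (z ^ (a - v - 1) * w^-1).
  rewrite -[1]addr0; apply: lval_geM; last exact: lval_geV.
  by apply: lval_geW (@lval_ge_zvar k (a - v - 1)); lia.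
(* As v < l, the entry -s = - z^v w serves as pivot to clear z^l. This leaves z^v [[1, z p],
   [0, z^b]], where p is a unit because v < l < a - 1. *)
pose p := 1 - z ^ (a - v - 1) * w^-1.
have nz' : z ^ v * (z ^ (rep_class a (inr t)) * z ^ v) - z ^ v * z * p * 0 != 0.
  by rewrite mulr0 subr0 !mulf_neq0 ?zvarX_neq0.
apply: double_coset_trans (double_coset_Pimx_scaled (val_gl2 nz') cls1 p0 p1) _.
apply: (@double_coset_mx22 _ _ _ (z ^ (l - v)) w^-1 (- w) 0 1 0 0 1) => //.
- by apply: laurent_integral_zvarX; lia.
- exact: lval_geV.
- exact: lval_geN.
- by rewrite mulr0 sub0r mulrN opprK mulVf // lcoef1 oner_eq0.
- exact: laurent_even1.
- exact: laurent_even1.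
- by rewrite mulr1 mulr0 subr0 oner_eq0.
- rewrite val_gl2 val_gl2 !mulmx22 clsE sE /p.
  rewrite (_ : a + l - 2 * v = a + l - v - v); last by ring.
  rewrite !zvarXB zvarXD expr1z.
  have vn0 := zvarX_neq0 k v.
  move: (z ^ l) (z ^ a) (z ^ v) vn0 => Z A V vn0.
  by congr mx22; field; do ?[apply/andP; split].
Qed.

End Representatives.

(** * Counting truncated series of given valuation *)

Lemma card_lead_idx_lt (k : finFieldType) (m i : nat) : (i < m)%N ->
  #|[set t : {ffun 'I_m -> k} | lead_idx t == i]%SET| =
  ((#|k| - 1) * #|k| ^ (m - i.+1))%N.
Proof.
(* The set is a product: coordinates before i are zero, the one at i is nonzero, and the m - i - 1
   later ones are free. *)
move=> im; pose F (j : nat) : pred k :=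
  if (j < i)%N then pred1 0 else if j == i then predC1 0 else predT.
have -> : #|[set t : {ffun 'I_m -> k} | lead_idx t == i]%SET| =
    #|family (fun j : 'I_m => F j)|.
  apply: eq_card => t; rewrite inE; apply/eqP/familyP => [ti j|tF].
    rewrite /F -!topredE /=; case: ltngtP => [ji|//|ji].
    - rewrite -ti in ji; have /negbFE := before_find 0 ji.
      by rewrite codom_ffun nth_fgraph_ord.
    - have := @nth_find _ 0 (fun c => c != 0) (codom t).
      rewrite -/(lead_idx t) ti has_find size_codom card_ord -/(lead_idx t) ti.
      by move=> /(_ im); rewrite codom_ffun -ji nth_fgraph_ord.
  have tE (j : 'I_m) : nth 0 (codom t) j = t j.
    by rewrite codom_ffun nth_fgraph_ord.
  have ti : nth 0 (codom t) i != 0.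
    have := tF (Ordinal im); rewrite /F ltnn eqxx -topredE /=.
    by rewrite -tE.
  case: (ltngtP (lead_idx t) i) => // [lt|gt].
    have lm := ltn_trans lt im.
    have := tF (Ordinal lm); rewrite /F /= lt -topredE /= -tE /=.
    have := @nth_find _ 0 (fun c => c != 0) (codom t).
    by rewrite has_find size_codom card_ord => /(_ lm)/negbTE ->.
  by have := before_find 0 gt; rewrite ti.
rewrite card_family /image_mem foldrE big_map big_enum /=.
rewrite -(big_mkord xpredT (fun j => #|F j|)).
rewrite (big_cat_nat _ (n := i)) //=; last exact: ltnW.
rewrite big_nat big1 => [|j /andP[_ ji]]; last first.
  by rewrite /F ji card1.
rewrite mul1n big_ltn // {1}/F ltnn eqxx cardC1 subn1; congr (_ * _)%N.
rewrite big_nat (eq_bigr (fun=> #|k|)) => [|j /andP[ij _]]; last first.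
  by rewrite /F ltnNge (ltnW ij) /= gtn_eqF // cardT.
by rewrite -big_nat prod_nat_const_nat.
Qed.

Lemma card_lead_idx_eq (k : finFieldType) (m : nat) :
  #|[set t : {ffun 'I_m -> k} | lead_idx t == m]%SET| = 1%N.
Proof.
rewrite -(cards1 ([ffun=> 0] : {ffun 'I_m -> k})).
apply: eq_card => t; rewrite !inE; apply/eqP/eqP => [tm|->].
  apply/ffunP => j; rewrite ffunE -lcoef_trunc_ser.
  by rewrite (trunc_ser_eq0 tm).
rewrite /lead_idx hasNfind ?size_codom ?card_ord //.
by apply/hasPn => c /codomP[j ->]; rewrite ffunE eqxx.
Qed.

(** * The structure constant as a number of points of the projective line *)

Section StructureConstant.
Variables (k : finFieldType) (n : nat).
Variables (R : realType) (mu : {measure set (GL2 k) -> \bar R}).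
Hypotheses (haar_mu : left_haar mu) (mu_K : mu (Kgrp k) = 1%E).
Local Notation l := (n.+1%:Z).

Lemma struct_const_card (a b : int) : l < a - 1 -> 1 <= b ->
  struct_const mu l a b =
  (#|[set u : P1 k n | rep_class a u == b]%SET|%:R)%:E.
Proof.
move=> la b1; pose A := [set u : P1 k n | rep_class a u == b]%SET.
pose K := Kgrp k; pose F (u : P1 k n) := [set (rep u * x)%g | x in K].
pose S := \bigcup_(u in [set` A]) F u.
(* S is the support of the integrand. Replacing y by y x with x in K multiplies y^-1 Pi^a on the
   left by x^-1, so each coset lies wholly inside or outside; disjointness of the double cosets
   rules out the points u of another class. *)
have SE y : S y <-> double_coset K (diagz k (- l)) K y /\
    double_coset K (Pimx k b) (Hgrp k) (y^-1 * Pimx k a)%g.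
  have trans_l (u : P1 k n) x : K x ->
      double_coset K ((rep u)^-1 * Pimx k a)%g (Hgrp k)
        ((rep u * x)^-1 * Pimx k a)%g.
    move=> Kx; exists (x^-1)%g; first exact: GL2_overV.
    exists 1%g; first exact: GL2_over1 (laurent_even_subring k).
    by rewrite (invgM (rep u)) mulg1 mulgA.
  split=> [[u /= uA [x Kx <-]]|[/KDK_rep[u [x Kx <-]] yb]].
    split; first by apply/KDK_rep; exists u, x.
    move: uA; rewrite inE => /eqP <-.
    exact (double_coset_trans (repV_Pimx_double_coset u la) (trans_l u x Kx)).
  exists u; last by exists x.
  rewrite /= inE; apply/eqP; apply: Pimx_double_coset_inj yb => //.
    by apply: le_trans (rep_class_ge a u); lia.
  exact (double_coset_trans (repV_Pimx_double_coset u la) (trans_l u x Kx)).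
have mF u : measurable (F u) by exact: measurable_lcoset_Kgrp.
have muF u : mu (F u) = 1%E.
  exact (etrans (haar_lcoset_Kgrp (rep u) haar_mu) mu_K).
have mS : measurable S by apply: fin_bigcup_measurable.
rewrite /struct_const /convolution.
transitivity (\int[mu]_y (\1_S y)%:E)%E.
  apply: eq_integral => y _; congr EFin.
  rewrite /hecke_c /hecke_d !indicE -natrM mulnb.
  congr (_%:R); congr nat_of_bool.
  apply/andP/idP; rewrite !inE; first by move=> [? ?]; apply/SE.
  by move/SE => [].
rewrite integral_indic // setIT /S measure_fin_bigcup //; last first.
  move=> u u' _ _ [y [[x Kx <-] [x' Kx' E]]].
  exact/esym/(rep_inj Kx' Kx E).
rewrite (@fsbigE _ _ _ _ _ (enum A)) ?enum_uniq //; last 2 first.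
- by move=> u /=; rewrite mem_enum.
- by move=> u /= uA; rewrite mem_enum uA.
rewrite (eq_bigr (fun=> 1%E)) => [|u _]; last exact: muF.
rewrite sumEFin big_enum_cond (eq_bigl (mem A)) ?sumr_const // => u.
by rewrite andb_idr // => uA; rewrite inE.
Qed.

End StructureConstant.

Theorem theorem4p2 (k : finFieldType) (char_k : (2%N \notin [pchar k]))
  (R : realType) (mu : {measure set (GL2 k) -> \bar R})
  (haar_mu : left_haar mu) (mu_K : mu (Kgrp k) = 1%E)
  (l a : int) (l_ge1 : 1 <= l) (l_lt : l < a - 1) :
  [/\ forall j : int, 2 - l <= j <= l - 2 -> (2 %| l - j)%Z ->
        struct_const mu l a (a + j) =
          (#|k|%:R ^ (((j + l) %/ 2)%Z - 1) * (#|k|%:R - 1))%:E,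
      struct_const mu l a (a - l) = 1%E
    & struct_const mu l a (a + l) = (#|k|%:R ^ l)%:E].
Proof.
case: l l_ge1 l_lt => [[|n]|] // _ la.
(* These classes are below a + l, so the chart [c : 1] is excluded. The index i = n is allowed and
   stands for t = 0. *)
have class_inr (i : nat) :
    [set u : P1 k n | rep_class a u == a + n.+1%:Z - 2 * i.+1%:Z]%SET =
    [set inr t | t in [set t : {ffun 'I_n -> k} | lead_idx t == i]%SET]%SET.
  apply/setP => u; rewrite inE; apply/eqP/imsetP => [|[t]]; last first.
    by rewrite inE => /eqP ti ->; rewrite /= ti.
  case: u => [c|t] /= E; first by exfalso; lia.
  by exists t; rewrite // inE; apply/eqP; lia.
have card_inr i :
    #|[set u : P1 k n | rep_class a u == a + n.+1%:Z - 2 * i.+1%:Z]%SET| =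
    #|[set t : {ffun 'I_n -> k} | lead_idx t == i]%SET|.
  by rewrite class_inr card_imset //; exact: inr_inj.
have q1 : (1 <= #|k|)%N by apply/card_gt0P; exists 0.
split=> [j jn jl||].
(* Solving a + j = a + l - 2 (i + 1) for i; the bounds on j become 0 <= i < n, and n - i - 1 is (j +
   l) / 2 - 1. *)
- have [i iE im] : exists2 i : nat, j = n.+1%:Z - 2 * i.+1%:Z & (i < n)%N.
    exists `|((n.+1%:Z - j) %/ 2)%Z - 1|%N; lia.
  rewrite (struct_const_card haar_mu mu_K la) //; last lia.
  rewrite iE addrA card_inr card_lead_idx_lt // natrM natrB // natrX mulrC.
  congr (_ * _)%:E; rewrite exprnP; congr (_ ^ _); lia.
- rewrite (struct_const_card haar_mu mu_K la) //; last lia.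
  (* The case j = -l is i = n, whose only point is t = 0. *)
  rewrite (_ : a - n.+1%:Z = a + n.+1%:Z - 2 * n.+1%:Z); last by ring.
  by rewrite card_inr card_lead_idx_eq.
- rewrite (struct_const_card haar_mu mu_K la) //; last lia.
  rewrite (_ : [set u | _]%SET =
      [set inl c | c in [set: {ffun 'I_n.+1 -> k}]%SET]%SET).
    rewrite card_imset; last exact: inl_inj.
    by rewrite cardsT card_ffun card_ord natrX -exprnP.
  apply/setP => u; rewrite inE; apply/eqP/imsetP => [|[c _ ->] //].
  by case: u => [c|t] /= E; [exists c; rewrite ?inE | exfalso; lia].
Qed.
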